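(* Let $\mathbb{F}$ be a field, let $G$ be a finite group, let $n\ge 1$, and let $\rho : G \to \mathrm{GL}(\mathbb{F}^n)$ be an irreducible representation. Then for every $h \in G$ such that $\rho(h) \neq \mathbf{I}$ we have $$\operatorname{rank}(\rho(h) - \mathbf{I}) \;\geq\; \frac{\theta_{\mathbb{F}} \cdot \gamma_h \cdot n}{\log_2 |G|} \;\geq\; \frac{n}{3\log_2 |G|}.$$
   Context: $\mathbf{I}$ is the $n\times n$ identity matrix and $|G|$ is the order of $G$. The constant $\theta_{\mathbb{F}}$ is defined by $\theta_{\mathbb{F}} = 1$ if $\mathbb{F}$ is infinite, and $\theta_{\mathbb{F}} = 1 - \frac{1}{|\mathbb{F}|}$ if $\mathbb{F}$ is finite. For $h\in G$ with order $\mathrm{ord}(h)$ in $G$, the constant $\gamma_h$ is defined by $\gamma_h = 1$ if $\mathrm{ord}(h)$ is even, and $\gamma_h = 1 - \frac{1}{\mathrm{ord}(h)}$ if $\mathrm{ord}(h)$ is odd. *)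

(* Defs.v *)
From mathcomp Require Import all_boot all_order all_algebra all_fingroup all_character.
From mathcomp Require Import finmap.
From mathcomp Require Import boolp classical_sets cardinality reals exp.

Set Implicit Arguments.
Unset Strict Implicit.
Unset Printing Implicit Defensive.

Import GRing.Theory Num.Theory.

Local Open Scope ring_scope.

Definition log2 (R : realType) (x : R) : R := ln x / ln 2.

Definition theta (R : realType) (F : fieldType) : R :=
  if `[< finite_set [set: F]%classic >]
  then 1 - (#|` fset_set [set: F]%classic |%fset)%:R^-1
  else 1.

Definition gamma (R : realType) (gT : finGroupType) (h : gT) : R :=
  if odd #[h]%g then 1 - #[h]%g%:R^-1 else 1.

(* Main.v *)
Require Import Defs.
From mathcomp Require Import finmap boolp classical_sets cardinality exp lra.
From mathcomp Require Import all_boot all_order all_algebra all_fingroup all_character.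
From mathcomp Require Import reals.

(** Write [[V, N]] for the span of the images of the [rho x - 1], [x] in [N],
    where [N] is the normal closure of [h] in [G].  Since [N] is normal, this is
    a submodule; it is nonzero because [rho h] is not the identity, so by
    irreducibility it is the whole space.

    The point is that few conjugates of [h] suffice to span it.  If [X] generates
    [N], then the images of the [rho x - 1], [x] in [X], already span [[V, N]],
    because [gk - 1 = (g - 1)(k - 1) + (g - 1) + (k - 1)] (lemma
    [aug_sum_gen]).  And [N] is generated by a set [X] of at most [log2 #|N|]
    conjugates of [h], since each new generator at least doubles the subgroup
    generated so far (lemma [small_generating_subset]).  All these images have the
    same dimension [r], the rank of [rho h - 1], whence [n <= #|X| * r] and
    [2 ^ #|X| <= #|G|] (lemma [irr_dim_le_rank]), that is,
    [n <= r * log2 #|G|].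

    The first inequality follows as [theta] and [gamma] are at most [1].  For the
    second, [theta] is at least [1/2] because a field has at least two elements,
    and [gamma] is at least [2/3] because a nontrivial element of odd order has
    order at least [3]. *)

Set Implicit Arguments.
Unset Strict Implicit.
Unset Printing Implicit Defensive.

Import Order.TTheory GRing.Theory Num.Theory GroupScope.

Local Open Scope ring_scope.

(** Among the subsets [X] of [A] that satisfy the cardinality bound, one of
    maximal size generates: adjoining an element of [A] outside [<<X>>] would at
    least double [#|<<X>>|], by Lagrange, and so preserve the bound. *)
Lemma small_generating_subset (gT : finGroupType) (A : {set gT}) :
  exists X : {set gT},
    [/\ X \subset A, A \subset <<X>> & (2 ^ #|X| <= #|<<X>>|)%N].
Proof.
pose P (X : {set gT}) := (X \subset A) && (2 ^ #|X| <= #|<<X>>|)%N.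
have P0 : P set0 by rewrite /P sub0set cards0 expn0 cardG_gt0.
case: (arg_maxnP (fun X : {set gT} => #|X|) P0) => X /andP[sXA leX] maxX.
exists X; split=> //; apply/subsetP=> a Aa; apply/negPn/negP=> Xa.
have notXa : a \notin X by apply: contra Xa => /mem_gen.
suff /maxX : P (a |: X)%SET by rewrite cardsU1 notXa add1n /= ltnn.
rewrite /P subUset sub1set Aa sXA /= cardsU1 notXa expnD expn1.
have sXaX : <<X>> \subset <<(a |: X)%SET>> by rewrite genS // subsetUr.
rewrite -(Lagrange sXaX) mulnC leq_mul // indexg_gt1.
by apply: contra Xa => /subsetP; apply; rewrite mem_gen // !inE eqxx.
Qed.

Section AugmentationSum.

Variables (F : fieldType) (gT : finGroupType) (G : {group gT}) (n : nat).
Variable rG : mx_representation F G n.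

Definition aug_sum (A : {set gT}) : 'M[F]_n := (\sum_(x in A) (rG x - 1%:M))%MS.

Lemma aug_sum_sup (A : {set gT}) x :
  x \in A -> (rG x - 1%:M <= aug_sum A)%MS.
Proof. by move=> Ax; apply: (sumsmx_sup x). Qed.

(** The elements [g] of [G] such that [rG g - 1] has its row space in
    [aug_sum A] form a group: the row space of a product of matrices lies in that
    of its right factor, and [gk - 1 = (g - 1)(k - 1) + (g - 1) + (k - 1)]. *)
Lemma aug_sum_gen (A : {set gT}) g :
  A \subset G -> g \in <<A>> -> (rG g - 1%:M <= aug_sum A)%MS.
Proof.
move=> sAG; pose K := [set g in G | (rG g - 1%:M <= aug_sum A)%MS]%SET.
have gK : group_set K.
  apply/group_setP; split=> [|x y]; first by rewrite inE group1 repr_mx1 subrr sub0mx.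
  rewrite !inE => /andP[Gx Kx] /andP[Gy Ky]; rewrite groupM //=.
  have -> : rG (x * y)%g - 1%:M
      = (rG x - 1%:M) *m (rG y - 1%:M) + (rG x - 1%:M) + (rG y - 1%:M).
    by rewrite repr_mxM // mulmxBl mul1mx addrAC subrK mulmxBr mulmx1 addrA subrK.
  by rewrite (addmx_sub _ Ky) // (addmx_sub _ Kx) // (submx_trans (submxMl _ _) Ky).
have: <<A>> \subset Group gK.
  rewrite gen_subG; apply/subsetP=> x Ax.
  by rewrite inE (subsetP sAG) // aug_sum_sup.
by move=> /subsetP sub /sub; rewrite inE => /andP[].
Qed.

Lemma repr_conj_sub1 x g : x \in G -> g \in G ->
  rG (x ^ g)%g - 1%:M = rG g^-1%g *m (rG x - 1%:M) *m rG g.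
Proof.
move=> Gx Gg; rewrite mulmxBr mulmxBl mulmx1 -!repr_mxM ?groupM ?groupV //.
by rewrite mulVg repr_mx1 conjgE mulgA.
Qed.

Lemma mxrank_repr_conj_sub1 x g : x \in G -> g \in G ->
  \rank (rG (x ^ g)%g - 1%:M) = \rank (rG x - 1%:M).
Proof.
move=> Gx Gg; rewrite repr_conj_sub1 // mxrankMfree ?row_free_unit ?repr_mx_unit //.
by rewrite eqmxMfull // row_full_unit repr_mx_unit ?groupV.
Qed.

(** This rests on [(x - 1) g = g (x ^ g - 1)]; conjugates of [A] need only stay in
    the subgroup generated by [A], by [aug_sum_gen]. *)
Lemma aug_sum_mxmodule (A : {set gT}) :
    A \subset G -> {in A & G, forall x g, (x ^ g)%g \in <<A>>} ->
  mxmodule rG (aug_sum A).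
Proof.
move=> sAG nA; apply/mxmoduleP=> g Gg; rewrite sumsmxMr; apply/sumsmx_subP=> x Ax.
have Gx := subsetP sAG x Ax.
have -> : (rG x - 1%:M) *m rG g = rG g *m (rG (x ^ g)%g - 1%:M).
  by rewrite repr_conj_sub1 // !mulmxA -repr_mxM ?groupV // mulgV repr_mx1 mul1mx.
by apply: submx_trans (submxMl _ _) _; rewrite aug_sum_gen // nA.
Qed.

(** The logarithm-free form of the bound: [k] is the number of conjugates of [h]
    in a small generating set of the normal closure of [h]. *)
Lemma irr_dim_le_rank h : mx_irreducible rG -> h \in G -> rG h <> 1%:M ->
  exists2 k, (2 ^ k <= #|G|)%N & (n <= k * \rank (rG h - 1%:M)%R)%N.
Proof.
move=> [_ _ simG] Gh hI.
have [X [sXc scX leX]] := small_generating_subset (h ^: G).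
have scG : h ^: G \subset G by rewrite class_subG.
have sXG := subset_trans sXc scG.
exists #|X|.
  by apply: leq_trans leX _; rewrite subset_leq_card // gen_subG.
have modX : mxmodule rG (aug_sum X).
  apply: aug_sum_mxmodule => // x g Xx Gg; apply: (subsetP scX).
  by have /imsetP[y Gy ->] := subsetP sXc x Xx; rewrite -conjgM memJ_class ?groupM.
have nzX : aug_sum X != 0.
  apply/eqP=> X0; apply: hI; apply/eqP; rewrite -subr_eq0 -submx0 -X0.
  by rewrite aug_sum_gen // (subsetP scX) // class_refl.
have /mxrankS := simG _ modX (submx1 _) nzX; rewrite mxrank1 => /leq_trans; apply.
apply: leq_trans (mxrank_sum_leqif _) _ => /=.
rewrite -sum_nat_const leq_sum // => x Xx.
by have /imsetP[g Gg ->] := subsetP sXc x Xx; rewrite mxrank_repr_conj_sub1.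
Qed.

End AugmentationSum.

Section Constants.

Variable R : realType.

Lemma theta_le1 (F : fieldType) : theta R F <= 1.
Proof. by rewrite /theta; case: ifP => _ //; rewrite gerBl invr_ge0. Qed.

Lemma theta_ge (F : fieldType) : 2^-1 <= theta R F.
Proof.
rewrite /theta; case: ifPn => [/asboolP finF|_]; last by lra.
have card2 : (2 <= #|` fset_set [set: F]%classic|%fset)%N.
  have <- : #|` [fset (0 : F); 1]%fset|%fset = 2%N by rewrite cardfs2 eq_sym oner_eq0.
  apply: fsubset_leq_card; apply/fsubsetP=> x _.
  by rewrite in_fset_set // classical_sets.in_setT.
have : (#|` fset_set [set: F]%classic|%fset)%:R^-1 <= 2^-1 :> R.
  by rewrite lef_pV2 ?posrE ?ltr0n ?ler_nat // (leq_trans _ card2).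
lra.
Qed.

Lemma gamma_le1 (gT : finGroupType) (h : gT) : gamma R h <= 1.
Proof. by rewrite /gamma; case: ifP => _ //; rewrite gerBl invr_ge0. Qed.

Lemma gamma_ge (gT : finGroupType) (h : gT) : h != 1%g -> 2 / 3 <= gamma R h.
Proof.
rewrite -order_gt1 /gamma => h1; case: ifPn => [oddh|_]; last by lra.
have h3 : (3 <= #[h]%g)%N by case: #[h]%g h1 oddh => [|[|[|]]].
have : #[h]%g%:R^-1 <= 3^-1 :> R.
  by rewrite lef_pV2 ?posrE ?ltr0n ?ler_nat // (leq_trans _ h3).
lra.
Qed.

Lemma le_log2_nat (k m : nat) : (2 ^ k <= m)%N -> k%:R <= log2 (m%:R : R).
Proof.
move=> le_m; have ln2 : 0 < ln 2 :> R by rewrite ln_gt0 // ltr1n.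
have m_gt0 : (0 < m)%N by rewrite (leq_trans _ le_m) // expn_gt0.
rewrite /log2 ler_pdivlMr // mulr_natl -lnXn ?ltr0n // ler_ln ?posrE ?exprn_gt0 ?ltr0n //.
by rewrite -natrX ler_nat.
Qed.

End Constants.

Theorem theorem1p1 (R : realType) (F : fieldType) (gT : finGroupType)
    (G : {group gT}) (n : nat) (hn : (1 <= n)%N)
    (rho : mx_representation F G n) (irr : mx_irreducible rho)
    (h : gT) (hG : h \in G) (hI : rho h <> 1%:M) :
  (\rank (rho h - 1%:M))%:R >= theta R F * gamma R h * n%:R / log2 (#|G|%:R : R)
  /\ theta R F * gamma R h * n%:R / log2 (#|G|%:R : R)
     >= n%:R / (3 * log2 (#|G|%:R : R)).
Proof.
have [k leG le_n] := irr_dim_le_rank irr hG hI.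
have h_neq1 : h != 1%g by apply/eqP=> h1; apply: hI; rewrite h1 repr_mx1.
have k_gt0 : (0 < k)%N by case: k le_n {leG} => // /(leq_trans hn).
have le_k := le_log2_nat R leG.
set L := log2 _ in le_k *.
have L_gt0 : 0 < L by rewrite (lt_le_trans _ le_k) // ltr0n.
have t1 := theta_le1 R F; have t2 := theta_ge R F.
have g1 := gamma_le1 R h; have g2 := gamma_ge R h_neq1.
have n_ge0 : 0 <= n%:R :> R by [].
split.
  rewrite ler_pdivrMr //; apply: (@le_trans _ _ n%:R).
    by rewrite ler_piMl // mulr_ile1 //; lra.
  apply: (@le_trans _ _ (k * \rank (rho h - 1%:M)%R)%:R); first by rewrite ler_nat.
  by rewrite natrM mulrC ler_wpM2l.
rewrite invfM mulrA ler_pM2r ?invr_gt0 // [_ / 3]mulrC ler_wpM2r //.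
have -> : 3^-1 = 2^-1 * (2 / 3) :> R by lra.
by rewrite ler_pM //; lra.
Qed.
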